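(* Let $R$ be a finite commutative ring, $V$ a finite $R$-module, $P$ a probability on $V$ that is constant on associates, and $Q$ a probability on $R$. Consider the pairs $(W,\rho)$ where $W=R\chi$ is a cyclic $R$-submodule of the dual module $\widehat V$ (with a chosen generator $\chi$) and $\rho$ is a character of the multiplicative group $U(R/\mathrm{ann}(W))$. Put \[\widehat P(\chi)=\sum_{b\in V}P(b)\chi(b),\qquad \widehat Q(\rho)=\sum_{a\in U(R)+\mathrm{ann}(W)}Q(a)\,\rho(a+\mathrm{ann}(W)).\] Then the eigenvalues, counted with multiplicity, of the transition matrix of the coin-toss walk on $V$ (with heads probability $\alpha$) are exactly the numbers $\alpha\widehat P(\chi)+(1-\alpha)\widehat Q(\rho)$, and those of the transition matrix of the affine walk on $V$ are exactly the numbers $\widehat P(\chi)\widehat Q(\rho)$, where $(W,\rho)$ ranges over all such pairs and each pair contributes exactly one eigenvalue (multiplicity one).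
   Context: Rings are unital; the zero ring is allowed, with trivial unit group. $U(R)$ is the group of units of $R$. Elements $v_1,v_2\in V$ are associates if $v_1=uv_2$ for some $u\in U(R)$; $P$ constant on associates means $P(uv)=P(v)$ for all $u\in U(R)$, $v\in V$. The dual module $\widehat V$ is the group of homomorphisms $\chi\colon (V,+)\to U(\mathbb C)$ (characters), made into an $R$-module via $(r\chi)(v)=\chi(rv)$, with group operation pointwise multiplication. For an $R$-module $W$, $\mathrm{ann}(W)=\{r\in R: rw=0 \text{ for all } w\in W\}$. For $a\in U(R)+\mathrm{ann}(W)$, $a+\mathrm{ann}(W)$ is a unit of $R/\mathrm{ann}(W)$. The transition matrix of a Markov chain on $V$ has $(x,y)$-entry equal to the one-step probability of moving from $x$ to $y$. Coin-toss walk with heads probability $\alpha\in[0,1]$: from $x\in V$, with probability $\alpha$ move to $x+b$ with $b$ chosen according to $P$, and with probability $1-\alpha$ move to $ax$ with $a$ chosen according to $Q$. Affine walk: from $x$, choose independently $a\in R$ according to $Q$ and $b\in V$ according to $P$ and move to $ax+b$. *)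

(* Defs.v *)
From HB Require Import structures.
From mathcomp Require Import all_boot all_order all_fingroup all_algebra.
From mathcomp Require Import cyclic generic_quotient ring_quotient complex reals.

Set Implicit Arguments.
Unset Strict Implicit.
Unset Printing Implicit Defensive.

Import GRing.Theory.
Local Open Scope ring_scope.
Local Open Scope quotient_scope.

(* Finite modules. The library's [finLmodType] excludes the zero ring as base
   ring, and the joins it declares prevent an HB structure on [pzRingType] made
   of [GRing.Lmodule] and [Finite]; so finiteness is a separate mixin, from which
   the [Finite] instance is derived. *)
HB.mixin Record isFinPzLmodule (R : pzRingType) M of GRing.Lmodule R M := {
  lmod_enum : seq M;
  lmod_enumP : Finite.axiom lmod_enum
}.

#[short(type="finPzLmodType")]
HB.structure Definition FinPzLmodule (R : pzRingType) :=
  {M of isFinPzLmodule R M & GRing.Lmodule R M}.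

Section FinPzLmodule.

Variables (R : pzRingType) (M : finPzLmodType R).

Fact lmod_mem_enum (x : M) : x \in (lmod_enum : seq M).
Proof. by rewrite -has_pred1 has_count lmod_enumP. Qed.

Fact lmod_pickleK :
  pcancel (fun x : M => index x lmod_enum) (onth (lmod_enum : seq M)).
Proof.
move=> x; have Mx := lmod_mem_enum x.
by rewrite onthE (nth_map x) ?index_mem // nth_index.
Qed.

#[non_forgetful_inheritance]
HB.instance Definition _ :=
  Choice_isCountable.Build (FinPzLmodule.sort M) lmod_pickleK.

#[non_forgetful_inheritance]
HB.instance Definition _ := isFinite.Build (FinPzLmodule.sort M) lmod_enumP.

End FinPzLmodule.

Section Units.

Variable A : finComPzRingType.

Definition is_unit (a : A) := [exists b, a * b == 1].

Inductive units := Units (a : A) of is_unit a.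

Definition units_val u := let: Units a _ := u in a.

HB.instance Definition _ := [isSub for units_val].
HB.instance Definition _ := [Finite of units by <:].

Fact units_one_proof : is_unit 1.
Proof. by apply/existsP; exists 1; rewrite mulr1. Qed.

Fact units_mul_proof (u v : units) : is_unit (val u * val v).
Proof.
case: u v => [a /existsP[a' /eqP aa']] [b /existsP[b' /eqP bb']] /=.
by apply/existsP; exists (a' * b'); rewrite mulrACA aa' bb' mulr1.
Qed.

Definition units_pinv (a : A) := odflt 1 [pick b | a * b == 1].

Fact units_pinvP (u : units) : val u * units_pinv (val u) = 1.
Proof.
rewrite /units_pinv; case: pickP => [b /eqP // | no_inv].
by case/existsP: (valP u) => b; rewrite no_inv.
Qed.

Fact units_inv_proof (u : units) : is_unit (units_pinv (val u)).
Proof. by apply/existsP; exists (val u); rewrite mulrC units_pinvP. Qed.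

Definition units_one := Units units_one_proof.
Definition units_mul u v := Units (units_mul_proof u v).
Definition units_inv u := Units (units_inv_proof u).

Fact units_mulA : associative units_mul.
Proof. by move=> u v w; apply/val_inj/mulrA. Qed.
Fact units_mul1 : left_id units_one units_mul.
Proof. by move=> u; apply/val_inj/mul1r. Qed.
Fact units_mulV : left_inverse units_one units_inv units_mul.
Proof. by move=> u; apply/val_inj; rewrite /= mulrC units_pinvP. Qed.

HB.instance Definition _ :=
  Finite_isGroup.Build units units_mulA units_mul1 units_mulV.

(* Elements that are not units are sent to the junk value 1. *)
Definition to_units (a : A) : units := insubd units_one a.

Lemma to_unitsK a : is_unit a -> val (to_units a) = a.
Proof. by move=> Ua; rewrite val_insubd Ua. Qed.

End Units.

(* Homomorphisms from a finite group to the unit group of C. *)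
Section LinearCharacters.

Variables (C : closedFieldType) (G : finGroupType).

Definition is_lchar (f : {ffun G -> C}) :=
  (f 1%g == 1) && [forall x, forall y, f (x * y)%g == f x * f y].

Inductive lchar := LChar (f : {ffun G -> C}) of is_lchar f.

Definition lchar_val chi := let: LChar f _ := chi in f.
Definition lchar_fun chi : G -> C := lchar_val chi.
Coercion lchar_fun : lchar >-> Funclass.

HB.instance Definition _ := [isSub for lchar_val].
HB.instance Definition _ := [Choice of lchar by <:].

Lemma lcharP (chi psi : lchar) : chi =1 psi -> chi = psi.
Proof. by move=> eq_f; apply/val_inj/ffunP. Qed.

Lemma lchar1 (chi : lchar) : chi 1%g = 1.
Proof. by have /andP[/eqP] := valP chi. Qed.

Lemma lcharM (chi : lchar) x y : chi (x * y)%g = chi x * chi y.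
Proof. by have /andP[_ /forallP/(_ x)/forallP/(_ y)/eqP] := valP chi. Qed.

Lemma lchar_neq0 (chi : lchar) x : chi x != 0.
Proof.
apply/eqP => chix0; have := lcharM chi x x^-1%g.
by rewrite mulgV lchar1 chix0 mul0r => /eqP; rewrite oner_eq0.
Qed.

Lemma lcharX (chi : lchar) x n : chi (x ^+ n)%g = chi x ^+ n.
Proof. by elim: n => [|n IHn]; rewrite ?lchar1 // expgS lcharM IHn exprS. Qed.

Definition unity_roots : seq C :=
  sval (closed_field_poly_normal ('X^#|G| - 1 : {poly C})).

Fact lchar_unity_roots (chi : lchar) x : chi x \in unity_roots.
Proof.
rewrite /unity_roots; case: closed_field_poly_normal => s /= Es.
have Gn0 : (0 < #|G|)%N by rewrite -cardsT cardG_gt0.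
have rt : root ('X^#|G| - 1 : {poly C}) (chi x).
  rewrite /root !hornerE -lcharX -cardsT.
  by rewrite expg_cardG ?inE // lchar1 subrr.
move: rt; rewrite Es rootZ ?root_prod_XsubC // lead_coef_eq0.
by rewrite monic_neq0 // monicXnsubC.
Qed.

Definition lchar_code (chi : lchar) : {ffun G -> seq_sub unity_roots} :=
  [ffun x => SeqSub (lchar_unity_roots chi x)].

Definition lchar_decode (g : {ffun G -> seq_sub unity_roots}) : option lchar :=
  insub [ffun x => ssval (g x)].

Fact lchar_codeK : pcancel lchar_code lchar_decode.
Proof.
move=> chi; rewrite /lchar_decode.
have -> : [ffun x => ssval (lchar_code chi x)] = val chi.
  by apply/ffunP => x; rewrite !ffunE.
by rewrite valK.
Qed.

HB.instance Definition _ := Choice_isCountable.Build lchar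
  (pcan_pickleK lchar_codeK).
HB.instance Definition _ : isFinite lchar := PCanIsFinite lchar_codeK.

Fact lchar_zero_proof : is_lchar [ffun=> 1].
Proof.
apply/andP; split; first by rewrite ffunE.
by apply/forallP => x; apply/forallP => y; rewrite !ffunE mulr1.
Qed.

Fact lchar_add_proof (chi psi : lchar) : is_lchar [ffun x => chi x * psi x].
Proof.
apply/andP; split; first by rewrite ffunE !lchar1 mulr1.
by apply/forallP => x; apply/forallP => y; rewrite !ffunE !lcharM mulrACA.
Qed.

Fact lchar_opp_proof (chi : lchar) : is_lchar [ffun x => (chi x)^-1].
Proof.
apply/andP; split; first by rewrite ffunE lchar1 invr1.
by apply/forallP => x; apply/forallP => y; rewrite !ffunE lcharM invfM.
Qed.

Definition lchar_zero := LChar lchar_zero_proof.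
Definition lchar_add chi psi := LChar (lchar_add_proof chi psi).
Definition lchar_opp chi := LChar (lchar_opp_proof chi).

Lemma lchar_zeroE x : lchar_zero x = 1. Proof. exact: ffunE. Qed.
Lemma lchar_addE chi psi x : lchar_add chi psi x = chi x * psi x.
Proof. exact: ffunE. Qed.
Lemma lchar_oppE chi x : lchar_opp chi x = (chi x)^-1.
Proof. exact: ffunE. Qed.

Fact lchar_addA : associative lchar_add.
Proof. by move=> a b c; apply: lcharP => x; rewrite !lchar_addE mulrA. Qed.
Fact lchar_addC : commutative lchar_add.
Proof. by move=> a b; apply: lcharP => x; rewrite !lchar_addE mulrC. Qed.
Fact lchar_add0 : left_id lchar_zero lchar_add.
Proof. by move=> a; apply: lcharP => x; rewrite lchar_addE lchar_zeroE mul1r. Qed.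
Fact lchar_addN : left_inverse lchar_zero lchar_opp lchar_add.
Proof.
move=> a; apply: lcharP => x.
by rewrite lchar_addE lchar_oppE lchar_zeroE mulVf ?lchar_neq0.
Qed.

(* Pointwise multiplication, written additively. *)
HB.instance Definition _ :=
  GRing.isZmodule.Build lchar lchar_addA lchar_addC lchar_add0 lchar_addN.

End LinearCharacters.

Section Dual.

Variables (C : closedFieldType) (R : finComPzRingType) (V : finPzLmodType R).

(* The additive group of V is its canonical [finGroupType] structure. *)
Definition dual := lchar C (FinRing.Zmodule_to_finGroup V).

HB.instance Definition _ := Finite.on dual.
HB.instance Definition _ := GRing.Zmodule.on dual.

Lemma dual0 (chi : dual) : chi (0 : V) = 1. Proof. exact: lchar1. Qed.
Lemma dualD (chi : dual) (v w : V) : chi (v + w) = chi v * chi w.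
Proof. exact: lcharM. Qed.

Fact dual_scale_proof (r : R) (chi : dual) :
  is_lchar [ffun v : FinRing.Zmodule_to_finGroup V => chi (r *: (v : V))].
Proof.
apply/andP; split; first by rewrite ffunE scaler0 dual0.
by apply/forallP => x; apply/forallP => y; rewrite !ffunE scalerDr dualD.
Qed.

Definition dual_scale r chi : dual := LChar (dual_scale_proof r chi).

Lemma dual_scaleE r chi (v : V) : dual_scale r chi v = chi (r *: v).
Proof. exact: ffunE. Qed.

Fact dual_scaleA a b chi :
  dual_scale a (dual_scale b chi) = dual_scale (a * b) chi.
Proof. by apply: lcharP => v; rewrite !dual_scaleE scalerA mulrC. Qed.
Fact dual_scale1 : left_id 1 dual_scale.
Proof. by move=> chi; apply: lcharP => v; rewrite dual_scaleE scale1r. Qed.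
Fact dual_scaleDr : right_distributive dual_scale +%R.
Proof.
move=> a chi psi; apply: lcharP => v.
by rewrite dual_scaleE !lchar_addE !dual_scaleE.
Qed.
Fact dual_scaleDl chi : {morph dual_scale^~ chi : a b / a + b}.
Proof.
move=> a b; apply: lcharP => v; rewrite dual_scaleE scalerDl dualD.
by rewrite lchar_addE !dual_scaleE.
Qed.

HB.instance Definition _ := GRing.Zmodule_isLmodule.Build R dual
  dual_scaleA dual_scale1 dual_scaleDr dual_scaleDl.

Definition cyclic_submod (chi : dual) : {set dual} := [set r *: chi | r : R].

Definition is_cyclic (W : {set dual}) := [exists chi, W == cyclic_submod chi].

Definition ann (W : {set dual}) : {pred R} :=
  [pred r | [forall chi in W, r *: chi == 0]].

Variable W : {set dual}.

Lemma annP r : reflect (forall w, w \in W -> r *: w = 0) (r \in ann W).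
Proof. by apply: (iffP forall_inP) => rW w /rW/eqP. Qed.

Fact ann_zmod_closed : zmod_closed (ann W).
Proof.
split=> [|r s /annP rW /annP sW]; apply/annP => w Ww; first by rewrite scale0r.
by rewrite scalerBl rW // sW // subrr.
Qed.

HB.instance Definition _ := GRing.isZmodClosed.Build R (ann W) ann_zmod_closed.

Lemma annMl r s : s \in ann W -> r * s \in ann W.
Proof. by move/annP=> sW; apply/annP => w Ww; rewrite -scalerA sW ?scaler0. Qed.

(* R / ann W. The library's quotient rings need a proper ideal, whereas
   ann W = R when W = 0. *)
Definition annq := Quotient.quot (ann W : zmodClosed R).

HB.instance Definition _ := GRing.Zmodule.on annq.
HB.instance Definition _ :
    EqQuotient R (Quotient.equiv (ann W : zmodClosed R)) annq :=
  EqQuotient.on annq.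

Fact annq_reprK : cancel (@generic_quotient.repr R annq) \pi_annq.
Proof. exact: generic_quotient.reprK. Qed.

HB.instance Definition _ := Choice_isCountable.Build annq
  (pcan_pickleK (can_pcan annq_reprK)).
HB.instance Definition _ : isFinite annq := CanIsFinite annq_reprK.

Definition annq_one : annq := lift_cst annq 1.
Definition annq_mul : annq -> annq -> annq := lift_op2 annq *%R.

Fact annq_piP (r s : R) : reflect (\pi_annq r = \pi_annq s) (r - s \in ann W).
Proof. by rewrite (Quotient.idealrBE (ann W : zmodClosed R)); apply: eqP. Qed.

Lemma annq_pi1 : \pi_annq 1 = annq_one.
Proof. by unlock annq_one. Qed.

Lemma annq_piM : {morph \pi_annq : r s / r * s >-> annq_mul r s}.
Proof.
move=> r s; unlock annq_mul; apply/annq_piP.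
set r' := generic_quotient.repr _; set s' := generic_quotient.repr _.
have rr' : r - r' \in ann W by apply/annq_piP; rewrite annq_reprK.
have ss' : s - s' \in ann W by apply/annq_piP; rewrite annq_reprK.
have -> : r * s - r' * s' = s * (r - r') + r' * (s - s').
  by rewrite !mulrBr ![s * _]mulrC addrA subrK.
by rewrite rpredD ?annMl.
Qed.

Fact annq_mulA : associative annq_mul.
Proof.
move=> x y z; rewrite -[x]annq_reprK -[y]annq_reprK -[z]annq_reprK.
by rewrite -!annq_piM mulrA.
Qed.
Fact annq_mulC : commutative annq_mul.
Proof.
move=> x y; rewrite -[x]annq_reprK -[y]annq_reprK.
by rewrite -!annq_piM mulrC.
Qed.
Fact annq_mul1 : left_id annq_one annq_mul.
Proof. by move=> x; rewrite -[x]annq_reprK -annq_pi1 -annq_piM mul1r. Qed.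
Fact annq_mulDl : left_distributive annq_mul +%R.
Proof.
move=> x y z; rewrite -[x]annq_reprK -[y]annq_reprK -[z]annq_reprK.
have piD : {morph \pi_annq : r s / r + s} by exact: Quotient.pi_add.
by rewrite -!annq_piM -!piD -annq_piM mulrDl.
Qed.

HB.instance Definition _ := GRing.Zmodule_isComPzRing.Build annq
  annq_mulA annq_mulC annq_mul1 annq_mulDl.

Definition units_add_ann : {set R} :=
  [set val u + c | u : units R, c : R in ann W].

Lemma units_add_annP a : a \in units_add_ann -> is_unit (\pi_annq a).
Proof.
case/imset2P=> u c _ Wc ->; have /existsP[v /eqP uv] := valP u.
apply/existsP; exists (\pi_annq v); apply/eqP.
apply: etrans (esym (annq_piM _ _)) (etrans _ annq_pi1).
apply/annq_piP; rewrite mulrDl uv addrAC subrr add0r mulrC.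
exact: annMl.
Qed.

End Dual.

Section Walks.

Variables (K : realType) (R : finComPzRingType) (V : finPzLmodType R).
Implicit Types (P : V -> K) (Q : R -> K).

Definition is_probability (T : finType) (p : T -> K) :=
  (forall x, 0 <= p x) /\ \sum_x p x = 1.

Definition associates (v1 v2 : V) := exists u : units R, v1 = val u *: v2.

Definition constant_on_associates P :=
  forall v1 v2, associates v1 v2 -> P v1 = P v2.

Definition coin_toss_walk (alpha : K) P Q (x y : V) : K :=
  alpha * (\sum_(b | x + b == y) P b)
  + (1 - alpha) * (\sum_(a | a *: x == y) Q a).

Definition affine_walk P Q (x y : V) : K :=
  \sum_(a : R) \sum_(b : V | a *: x + b == y) Q a * P b.

(* The states are numbered by the enumeration of the finite type V. *)
Definition transition_matrix (p : V -> V -> K) : 'M[K]_#|V| :=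
  \matrix_(i, j) p (enum_val i) (enum_val j).

Local Open Scope complex_scope.

Definition Phat P (chi : dual K[i] V) : K[i] := \sum_(b : V) (P b)%:C * chi b.

(* By [units_add_annP] the junk value of [to_units] is never used. *)
Definition Qhat Q (W : {set dual K[i] V})
    (rho : lchar K[i] (units (annq W))) : K[i] :=
  \sum_(a in units_add_ann W) (Q a)%:C * rho (to_units (\pi_(annq W) a)).

End Walks.

(* Main.v *)
Require Import Defs.
From HB Require Import structures.
From mathcomp Require Import all_boot all_order all_fingroup all_algebra.
From mathcomp Require Import separable cyclotomic mxrepresentation.
From mathcomp Require Import generic_quotient complex reals.

(* The characters of V form a basis of the functions on V. A transition matrix
   sends chi to A(chi) chi + B(chi) sum_a Q(a) (a chi), with A = alpha P^ and
   B = 1 - alpha for the coin-toss walk, A = 0 and B = P^ for the affine walk;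
   A and B are constant on associates. Since a chi lies in R chi, this is block
   triangular for the inclusion of cyclic submodules. As units of R / ann W lift
   to units of R, the generators of W form one orbit u gen(W) with u in
   U(R / ann W), on which A and B are constant; the diagonal block of W is thus
   a convolution operator on this abelian group, and its characters rho
   diagonalize it. *)

Set Implicit Arguments.
Unset Strict Implicit.
Unset Printing Implicit Defensive.

Import Order.TTheory GRing.Theory Num.Theory.
Local Open Scope ring_scope.
Local Open Scope complex_scope.

(** * Characteristic polynomials of matrices indexed by finite types *)

Section CharPolyOfKernel.

Variable C : fieldType.

Definition fin_mx (I J : finType) (a : I -> J -> C) : 'M[C]_(#|I|, #|J|) :=
  \matrix_(i, j) a (enum_val i) (enum_val j).

Lemma mul_fin_mx (I J L : finType) (a : I -> J -> C) (b : J -> L -> C) :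
  fin_mx a *m fin_mx b = fin_mx (fun i l => \sum_j a i j * b j l).
Proof.
apply/matrixP => i l; rewrite !mxE (reindex _ (onW_bij _ (enum_val_bij J))) /=.
by apply: eq_bigr => j _; rewrite !mxE.
Qed.

Lemma eq_fin_mx (I J : finType) (a b : I -> J -> C) :
  (forall i j, a i j = b i j) -> fin_mx a = fin_mx b.
Proof. by move=> eq_ab; apply/matrixP => i j; rewrite !mxE. Qed.

Lemma fin_mx1 (I : finType) : fin_mx (fun i j : I => (i == j)%:R) = 1%:M.
Proof. by apply/matrixP => i j; rewrite !mxE (inj_eq enum_val_inj). Qed.

Lemma char_poly_tr n (A : 'M[C]_n) : char_poly A^T = char_poly A.
Proof.
rewrite /char_poly -det_tr; congr (\det _).
by apply/matrixP => i j; rewrite !mxE eq_sym.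
Qed.

(** The two-sided inverse forces [m = n]. Then [S], seen over the polynomial ring, intertwines the
    two characteristic matrices, and its nonzero determinant cancels. *)
Lemma char_poly_intertwine m n (A : 'M[C]_m) (B : 'M[C]_n)
    (S : 'M[C]_(m, n)) (T : 'M[C]_(n, m)) :
  S *m T = 1%:M -> T *m S = 1%:M -> A *m S = S *m B ->
  char_poly A = char_poly B.
Proof.
move=> ST TS AS; have eq_mn : m = n.
  by apply/eqP; rewrite eqn_leq (mulmx1_min ST) (mulmx1_min TS).
case: n / eq_mn in B S T ST TS AS *.
have SX : char_poly_mx A *m map_mx polyC S = map_mx polyC S *m char_poly_mx B.
  by rewrite /char_poly_mx mulmxBl mulmxBr scalar_mxC -!map_mxM AS.
have S_unit : \det (map_mx polyC S) != 0.
  have : \det (map_mx polyC (S *m T)) != 0.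
    by rewrite ST map_scalar_mx /= polyC1 det1 oner_eq0.
  by rewrite map_mxM det_mulmx mulf_eq0 negb_or => /andP[].
by apply: (mulIf S_unit); rewrite -det_mulmx SX det_mulmx mulrC.
Qed.

(** In the Leibniz formula, a permutation [s] with nonzero term lowers [h] strictly at every moved
    index. The sum of [h] is invariant under reindexing by [s], so [s] moves nothing and only the
    diagonal term survives. *)
Lemma char_poly_triangular (I : finType) (a : I -> I -> C) (h : I -> nat) :
  (forall i j, a i j != 0 -> i != j -> (h j < h i)%N) ->
  char_poly (fin_mx a) = \prod_i ('X - (a i i)%:P).
Proof.
move=> tri; rewrite /char_poly /determinant (bigD1 1%g) //=.
rewrite [X in _ + X]big1 ?addr0.
  rewrite odd_perm1 expr0 mul1r [RHS](reindex _ (onW_bij _ (enum_val_bij I))) /=.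
  by apply: eq_bigr => i _; rewrite !mxE perm1 eqxx.
move=> s s_neq1; suff [i /eqP Dsi0] :
    exists i, char_poly_mx (fin_mx a) i (s i) == 0.
  by rewrite (bigD1 i) //= Dsi0 mul0r mulr0.
apply/existsP; apply: contraR s_neq1 => /existsPn nz.
pose g (i : 'I_#|I|) := h (enum_val i).
have g_s i : i != s i -> (g (s i) < g i)%N.
  move=> s_i; apply: tri; last by rewrite (inj_eq enum_val_inj).
  have := nz i; rewrite !mxE (negPf s_i) sub0r.
  by rewrite oppr_eq0 polyC_eq0.
have g_sum : (\sum_i g (s i) = \sum_i g i)%N.
  exact/esym/(reindex_inj (@perm_inj _ s)).
apply/eqP/permP => i; rewrite perm1; apply/eqP; apply: contraT => s_i.
suff : (\sum_i g (s i) < \sum_i g i)%N.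
  by rewrite g_sum ltnn.
rewrite (bigD1 i) //= [X in (_ < X)%N](bigD1 i) //=.
rewrite -addSn leq_add ?g_s ?[_ == s i]eq_sym // leq_sum // => j _.
by have [<-|/g_s/ltnW] := eqVneq j (s j).
Qed.

End CharPolyOfKernel.

Lemma fin_mx_intertwine (C : fieldType) (I J : finType) (a : I -> I -> C)
    (b : J -> J -> C) (s : I -> J -> C) (t : J -> I -> C) :
  (forall i i', \sum_j s i j * t j i' = (i == i')%:R) ->
  (forall j j', \sum_i t j i * s i j' = (j == j')%:R) ->
  (forall i j, \sum_i' a i i' * s i' j = \sum_j' s i j' * b j' j) ->
  char_poly (fin_mx a) = char_poly (fin_mx b).
Proof.
move=> st ts ab; apply: (@char_poly_intertwine _ _ _ _ _ (fin_mx s) (fin_mx t)).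
- by rewrite mul_fin_mx (eq_fin_mx st) fin_mx1.
- by rewrite mul_fin_mx (eq_fin_mx ts) fin_mx1.
- by rewrite !mul_fin_mx (eq_fin_mx ab).
Qed.

Lemma fin_mx_conj (C : fieldType) (I J : finType) (a : I -> I -> C)
    (s : I -> J -> C) (t : J -> I -> C) :
  (forall i i', \sum_j s i j * t j i' = (i == i')%:R) ->
  (forall j j', \sum_i t j i * s i j' = (j == j')%:R) ->
  char_poly (fin_mx a) =
    char_poly (fin_mx (fun j j' => \sum_i t j i * \sum_i' a i i' * s i' j')).
Proof.
move=> st ts; apply: (fin_mx_intertwine st ts) => i j.
under [RHS]eq_bigr do rewrite mulr_sumr.
rewrite [RHS]exchange_big [RHS](bigD1 i) //= [X in _ + X]big1 ?addr0; last first.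
  move=> i' neq; under eq_bigr do rewrite mulrA.
  by rewrite -mulr_suml st eq_sym (negPf neq) mul0r.
by under [RHS]eq_bigr do rewrite mulrA; rewrite -mulr_suml st eqxx mul1r.
Qed.

(** The minimal polynomial divides ['X^k - 1], which in characteristic 0 splits with distinct
    roots. *)
Lemma diagonalizable_expr1 (C : numClosedFieldType) n (A : 'M[C]_n) k :
  (0 < k)%N -> A ^+ k = 1 -> diagonalizable A.
Proof.
case: n A => [|n] A k_gt0 Ak1.
  by exists 1%:M; rewrite ?unitmx1 //; apply/is_diag_mxP => -[].
apply/diagonalizableP.
have [rs Drs] := closed_field_poly_normal ('X^k - 1 : {poly C}).
have mon : ('X^k - 1 : {poly C}) \is monic by exact: monicXnsubC.
move: Drs; rewrite (monicP mon) scale1r => Drs.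
exists rs.
  by rewrite -separable_prod_XsubC -Drs separable_Xn_sub_1 // pnatr_eq0 -lt0n.
rewrite -Drs; apply: mxminpoly_min.
by rewrite rmorphB rmorphXn /= horner_mx_X rmorph1 Ak1 subrr.
Qed.

(** * Characters of a finite abelian group: separation of points and orthogonality *)

Section Characters.

Variables (C : numClosedFieldType) (G : finGroupType).
Hypothesis mulgC : commutative (@mulg G).

(* Each diagonal position in a simultaneous diagonalization of the regular
   representation is a character; since that representation is faithful, one of
   these characters moves x. *)
Lemma lchar_separates (x : G) : x != 1%g -> exists chi : lchar C G, chi x != 1.
Proof.
move=> x_neq1; pose r := regular_repr C [set: G]%G.
have rM y z : r (y * z)%g = r y *m r z by rewrite repr_mxM ?inE.
have rX y k : r (y ^+ k)%g = r y ^+ k.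
  by elim: k => [|k IHk]; rewrite ?repr_mx1 // expgS rM IHk exprS.
(* The matrices [r y] commute, and each is diagonalizable because it has finite order; hence they
   are simultaneously diagonalizable. *)
have [|S S_unit /allP Sdiag] :=
    (codiagonalizableP [seq r y | y <- enum G]).1.
  split=> [A B /mapP[y _ ->] /mapP[z _ ->] | A /mapP[y _ ->]].
    by rewrite /comm_mx -!rM mulgC.
  apply: (@diagonalizable_expr1 _ _ _ #[y]%g) => //.
  by rewrite -rX expg_order repr_mx1.
pose d y := conjmx S (r y).
have dM y z : d (y * z)%g = d y *m d z.
  by rewrite /d !conjumx // rM !mulmxA mulmxKV.
have d1 : d 1%g = 1%:M by rewrite /d conjumx // repr_mx1 mulmx1 mulmxV.
have d_diag y i j : i != j -> d y i j = 0.
  have /Sdiag/is_diag_mxP := map_f r (mem_enum G y).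
  by apply.
have dE y : d y = diag_mx (\row_i d y i i).
  apply/matrixP => i j; rewrite [RHS]mxE [X in X *+ _]mxE.
  by have [->|/d_diag->] := eqVneq i j.
have chiP i : is_lchar [ffun y => d y i i].
  apply/andP; split; first by rewrite ffunE d1 mxE eqxx.
  apply/forallP => y; apply/forallP => z; rewrite !ffunE dM.
  by rewrite [X in X *m _]dE mul_diag_mx mxE [X in X * _]mxE.
have [i dx_i | dx1] := pickP (fun i => d x i i != 1).
  by exists (LChar (chiP i)); rewrite /lchar_fun /= ffunE.
(* All diagonal entries of [d x] are now 1, so [r x] is the identity, against faithfulness. *)
case/eqP: x_neq1; apply/set1P.
apply: (subsetP (regular_mx_faithful C [set: G]%G)).
rewrite inE inE mul1mx /=.
have dx : d x = 1%:M.
  rewrite dE; apply/matrixP => i j; rewrite mxE [X in X *+ _]mxE [RHS]mxE.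
  by have /eqP-> := negbFE (dx1 i).
move: dx; rewrite /d conjumx // => /(congr1 (mulmx (invmx S))).
rewrite mulmx1 !mulmxA mulVmx // mul1mx => /(congr1 (mulmxr S)) /=.
by rewrite mulmxKV // mulVmx // => ->.
Qed.

(** For nontrivial [chi], translation by some [x] with [chi x != 1] multiplies the sum by [chi x],
    so the sum vanishes. The trivial character is written 0. *)
Lemma sum_lchar_elt (chi : lchar C G) :
  \sum_x chi x = if chi == 0 then #|G|%:R else 0.
Proof.
have [->|chi_neq0] := eqVneq.
  by rewrite (eq_bigr (fun=> 1)) ?sumr_const // => x _; apply: lchar_zeroE.
have [x chix] : exists x, chi x != 1.
  apply/existsP; apply: contraR chi_neq0 => /existsPn chi1.
  apply/eqP/lcharP => x; rewrite lchar_zeroE.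
  by apply/eqP/negbNE/chi1.
apply/eqP; rewrite -(mulrI_eq0 _ (mulfI _ : GRing.lreg (chi x - 1))) ?subr_eq0 //.
rewrite mulrBl mul1r subr_eq0 mulr_sumr [eqbRHS](reindex_inj (mulgI x)) /=.
by apply/eqP/eq_bigr => y _; rewrite lcharM.
Qed.

(** Same translation argument, now in the character group, by a [psi] that separates [x] from 1. *)
Lemma sum_lchar_char (x : G) :
  \sum_(chi : lchar C G) chi x = if x == 1%g then #|{: lchar C G}|%:R else 0.
Proof.
have [->|/lchar_separates[psi psix]] := eqVneq.
  by rewrite (eq_bigr (fun=> 1)) ?sumr_const // => chi _; apply: lchar1.
apply/eqP; rewrite -(mulrI_eq0 _ (mulfI _ : GRing.lreg (psi x - 1))) ?subr_eq0 //.
rewrite mulrBl mul1r subr_eq0 mulr_sumr [eqbRHS](reindex_inj (addrI psi)) /=.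
by apply/eqP/eq_bigr => chi _; rewrite lchar_addE.
Qed.

(** The sum of all [chi x] is evaluated in both orders: only the trivial character contributes in
    one, only [x = 1] in the other. *)
Lemma card_lchar : #|{: lchar C G}| = #|G|.
Proof.
apply/eqP; rewrite -(eqr_nat C); apply/eqP.
have : \sum_(chi : lchar C G) \sum_x chi x = \sum_x \sum_(chi : lchar C G) chi x.
  exact: exchange_big.
under eq_bigr do rewrite sum_lchar_elt.
under [RHS]eq_bigr do rewrite sum_lchar_char.
by rewrite -!big_mkcond !big_pred1_eq => ->.
Qed.

Lemma lcharV (chi : lchar C G) x : chi (x^-1)%g = (chi x)^-1.
Proof.
apply: (mulfI (lchar_neq0 chi x)).
by rewrite -lcharM mulgV lchar1 divff ?lchar_neq0.
Qed.

Lemma lchar_orthogonal_elt (chi psi : lchar C G) :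
  \sum_x (chi x)^-1 * psi x = #|G|%:R * (chi == psi)%:R.
Proof.
have := sum_lchar_elt (psi - chi); rewrite subr_eq0 eq_sym.
under eq_bigr do rewrite lchar_addE lchar_oppE mulrC.
by move=> ->; case: ifP; rewrite ?mulr1 ?mulr0.
Qed.

Lemma lchar_orthogonal_char (x y : G) :
  \sum_(chi : lchar C G) (chi x)^-1 * chi y = #|G|%:R * (x == y)%:R.
Proof.
have := sum_lchar_char (x^-1 * y)%g; rewrite -eq_mulVg1 card_lchar.
under eq_bigr do rewrite lcharM lcharV.
by move=> ->; case: ifP; rewrite ?mulr1 ?mulr0.
Qed.

End Characters.

(** * Units modulo annihilators and generators of cyclic submodules *)

Lemma exists_idempotent_power (R : finComPzRingType) (a : R) :
  exists2 n, (0 < n)%N & a ^+ n * a ^+ n = a ^+ n.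
Proof.
pose f (i : 'I_#|R|.+1) := a ^+ i.
have /injectivePn[i [j neq_ij eq_f]] : ~~ injectiveb f.
  apply/injectiveP => /leq_card; rewrite card_ord ltnn //.
wlog lt_ij : i j neq_ij eq_f / (i < j)%N.
  move=> H; have := neq_ij; rewrite -val_eqE /= neq_ltn => /orP[] lt_ij.
    exact: (H i j).
  by apply: (H j i) => //; rewrite eq_sym.
pose p := (j - i)%N; have p_gt0 : (0 < p)%N by rewrite subn_gt0.
have per1 m : (i <= m)%N -> a ^+ (m + p) = a ^+ m.
  move=> le_im; rewrite -{1}(subnK le_im) -addnA subnKC ?(ltnW lt_ij) //.
  by rewrite exprD -[a ^+ j]eq_f -exprD subnK.
have per m k : (i <= m)%N -> a ^+ (m + p * k) = a ^+ m.
  move=> le_im; elim: k => [|k IHk]; first by rewrite muln0 addn0.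
  by rewrite mulnSr addnA per1 // (leq_trans le_im) ?leq_addr.
(* This exponent is a multiple of the period [p] and at least [i], so doubling it does not change
   the power. *)
exists (p * i.+1)%N; first by rewrite muln_gt0 p_gt0.
rewrite -exprD per //; apply: leq_trans (leqnSn i) _.
by rewrite leq_pmull.
Qed.

Section CyclicSubmodules.

Local Open Scope quotient_scope.

Variables (C : numClosedFieldType) (R : finComPzRingType) (V : finPzLmodType R).
Local Notation D := (dual C V).
Implicit Types (chi psi : D) (W : {set D}).

(* With e an idempotent power of a, the element ae + (1 - e) is a unit of R;
   modulo an ideal for which a is invertible, e is 1 and it agrees with a. *)
Lemma unit_mod_ann W (a : R) :
  is_unit (\pi_(annq W) a) = (a \in units_add_ann W).
Proof.
apply/idP/idP; last exact: units_add_annP.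
case/existsP=> b'; rewrite -[b']annq_reprK; move: (generic_quotient.repr b') => b.
move/eqP; rewrite -[LHS]annq_piM -[RHS]annq_pi1 => /annq_piP ab1.
have [[//|n] _ ee] := exists_idempotent_power a.
set e := a ^+ n.+1 in ee.
have e1 : 1 - e \in ann W.
  have abX k : 1 - a ^+ k * b ^+ k \in ann W.
    elim: k => [|k IHk]; first by rewrite mulr1 subrr rpred0.
    rewrite !exprS mulrACA -(subrK (a * b) 1) -addrA rpredD //.
      by rewrite -rpredN opprB.
    by rewrite -{1}[a * b]mulr1 -mulrBr annMl.
  (* Since [(1 - e) * e = 0], multiplying [1 - e * b ^+ n.+1] by [1 - e] leaves [1 - e]. *)
  have := annMl (1 - e) (abX n.+1).
  rewrite mulrBr mulr1 mulrA [(1 - e) * _]mulrBl -/e mul1r ee subrr mul0r.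
  by rewrite subr0.
have u_unit : is_unit (a * e + (1 - e)).
  (* Componentwise inverse along [e] and [1 - e]: the element [a ^+ n * e] inverts [a * e] relative
     to the identity [e]. *)
  apply/existsP; exists (a ^+ n * e + (1 - e)).
  have e0 : e * (1 - e) = 0 by rewrite mulrBr mulr1 ee subrr.
  have e00 : (1 - e) * (1 - e) = 1 - e by rewrite mulrBl mul1r e0 subr0.
  have t1 : a * e * (a ^+ n * e) = e by rewrite mulrACA -exprS -/e !ee.
  have t2 : a * e * (1 - e) = 0 by rewrite -mulrA e0 mulr0.
  have t3 : (1 - e) * (a ^+ n * e) = 0 by rewrite mulrC -mulrA e0 mulr0.
  rewrite mulrDl [a * e * _]mulrDr [(1 - e) * _]mulrDr t1 t2 t3 e00.
  by rewrite addr0 add0r addrC subrK.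
apply/imset2P; exists (Units u_unit) ((a - 1) * (1 - e)) => //=.
  by rewrite annMl.
by rewrite mulrBl mul1r addrACA subrr addr0 -mulrDr [e + _]addrC subrK mulr1.
Qed.

Lemma mem_cyclic chi : chi \in cyclic_submod chi.
Proof. by apply/imsetP; exists 1; rewrite ?scale1r. Qed.

Lemma cyclic_sub (r : R) chi : cyclic_submod (r *: chi) \subset cyclic_submod chi.
Proof.
apply/subsetP => _ /imsetP[s _ ->]; apply/imsetP.
by exists (s * r); rewrite ?scalerA.
Qed.

Lemma cyclic_submodP chi : is_cyclic (cyclic_submod chi).
Proof. by apply/existsP; exists chi. Qed.

Lemma ann_cyclic (r : R) chi : (r \in ann (cyclic_submod chi)) = (r *: chi == 0).
Proof.
apply/annP/eqP => [->|rchi _ /imsetP[s _ ->]]; rewrite ?mem_cyclic //.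
by rewrite scalerA mulrC -scalerA rchi scaler0.
Qed.

Variable gen : {set D} -> D.
Hypothesis genP : forall W, is_cyclic W -> W = cyclic_submod (gen W).

Section OneSubmodule.

Variables (W : {set D}).
Hypothesis cycW : is_cyclic W.

(** As [R] is commutative, what kills [gen W] kills [W]; so multiples of [gen W] correspond to
    classes in [R / ann W]. *)
Lemma eq_scale_gen (r s : R) :
  (r *: gen W == s *: gen W) = (\pi_(annq W) r == \pi_(annq W) s).
Proof.
rewrite -subr_eq0 -scalerBl -ann_cyclic -genP //.
by apply/annq_piP/eqP.
Qed.

(** The multiple generates [W] exactly when some [s] brings it back to [gen W], that is, when
    [s * r] is 1 modulo [ann W]. *)
Lemma cyclic_scale_gen (r : R) :
  (cyclic_submod (r *: gen W) == W) = is_unit (\pi_(annq W) r).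
Proof.
apply/eqP/existsP => [eqW | [s']].
  have : gen W \in W by have := mem_cyclic (gen W); rewrite -genP.
  rewrite -{2}eqW => /imsetP[s _ genE]; exists (\pi_(annq W) s).
  rewrite mulrC -[X in X == _]annq_piM -[X in _ == X]annq_pi1 -eq_scale_gen.
  by rewrite scale1r -scalerA -genE.
rewrite -[s']annq_reprK; move: (generic_quotient.repr s') => s.
rewrite -[X in X == _]annq_piM -[X in _ == X]annq_pi1 -eq_scale_gen scale1r.
rewrite mulrC -scalerA => /eqP genE; apply/eqP.
have := cyclic_sub r (gen W); have := cyclic_sub s (r *: gen W).
by rewrite genE -(genP cycW) eqEsubset => -> ->.
Qed.

(* Junk unless psi generates W. *)
Definition unit_coord psi : units (annq W) :=
  to_units (\pi_(annq W) (odflt 0 [pick r | r *: gen W == psi])).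

Lemma unit_coordE (r : R) : unit_coord (r *: gen W) = to_units (\pi_(annq W) r).
Proof.
rewrite /unit_coord; case: pickP => [s /= | /(_ r)]; last by rewrite eqxx.
by rewrite eq_scale_gen => /eqP->.
Qed.

Lemma generator_scale psi : cyclic_submod psi = W ->
  exists2 r, psi = r *: gen W & is_unit (\pi_(annq W) r).
Proof.
move=> eqW; have : psi \in W by rewrite -eqW mem_cyclic.
rewrite {1}(genP cycW) => /imsetP[r _ Dpsi]; exists r => //.
by rewrite -cyclic_scale_gen -Dpsi eqW.
Qed.

Definition of_unit_coord (u : units (annq W)) : D :=
  generic_quotient.repr (val u) *: gen W.

Lemma of_unit_coordK : cancel of_unit_coord unit_coord.
Proof.
move=> u; rewrite unit_coordE annq_reprK.
by apply/val_inj; rewrite to_unitsK //; apply: valP.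
Qed.

Lemma of_unit_coordP u : cyclic_submod (of_unit_coord u) = W.
Proof. by apply/eqP; rewrite cyclic_scale_gen annq_reprK; apply: (valP u). Qed.

Lemma unit_coordK psi : cyclic_submod psi = W -> of_unit_coord (unit_coord psi) = psi.
Proof.
case/generator_scale=> r -> r_unit; rewrite unit_coordE; apply/eqP.
by rewrite eq_scale_gen annq_reprK to_unitsK.
Qed.

Lemma unit_coord_inj psi psi' : cyclic_submod psi = W -> cyclic_submod psi' = W ->
  (unit_coord psi == unit_coord psi') = (psi == psi').
Proof.
move=> psiW psi'W; apply/eqP/eqP => [eq_c | -> //].
by rewrite -(unit_coordK psiW) eq_c unit_coordK.
Qed.

(** The coordinate [r] of [psi] is a unit modulo [ann W], so [a * r] is one exactly when [a] is.
    This is the origin of the summation range of [Qhat]. *)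
Lemma generator_scaleP (a : R) psi : cyclic_submod psi = W ->
  (cyclic_submod (a *: psi) == W) = (a \in units_add_ann W).
Proof.
case/generator_scale=> r -> r_unit; rewrite scalerA cyclic_scale_gen.
rewrite -unit_mod_ann; have -> : \pi_(annq W) (a * r) = \pi_(annq W) a * \pi_(annq W) r.
  exact: annq_piM.
apply/idP/idP => [/existsP[b]|ua].
  by rewrite -mulrA => ?; apply/existsP; exists (\pi_(annq W) r * b).
by have := units_mul_proof (Units ua) (Units r_unit).
Qed.

(** In unit coordinates the scalar [a] acts as a translation; hence the diagonal blocks are
    convolutions. *)
Lemma unit_coordM (a : R) psi : cyclic_submod psi = W -> a \in units_add_ann W ->
  unit_coord (a *: psi) = (to_units (\pi_(annq W) a) * unit_coord psi)%g.
Proof.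
move=> psiW aW; have arW : cyclic_submod (a *: psi) = W.
  by apply/eqP; rewrite generator_scaleP.
have [r Dpsi r_unit] := generator_scale psiW; move: arW; rewrite Dpsi scalerA.
move/eqP; rewrite cyclic_scale_gen => ar_unit; rewrite !unit_coordE; apply/val_inj.
rewrite /= !to_unitsK //; first exact: annq_piM.
exact: units_add_annP.
Qed.

(** By [unit_mod_ann] the coordinate of [psi] is a unit of [R] plus an element killing [W]. Thus
    functions constant on associates are constant on the generators of [W]. *)
Lemma generator_associate psi : cyclic_submod psi = W ->
  exists u : units R, psi = val u *: gen W.
Proof.
case/generator_scale=> r ->; rewrite unit_mod_ann => /imset2P[u c _ cW ->].
exists u; apply/eqP; rewrite eq_scale_gen; apply/eqP/annq_piP.
by rewrite addrAC subrr add0r.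
Qed.

End OneSubmodule.
End CyclicSubmodules.

(** * Block triangular form on the dual module *)

Section Triangularization.

Local Open Scope quotient_scope.

Variables (C : numClosedFieldType) (R : finComPzRingType) (V : finPzLmodType R).
Local Notation D := (dual C V).
Implicit Types (chi psi : D) (W : {set D}).

Variable gen : {set D} -> D.
Hypothesis genP : forall W, is_cyclic W -> W = cyclic_submod (gen W).

Variables (A B : D -> C) (q : R -> C).
Hypothesis A_assoc : forall (u : units R) chi, A (val u *: chi) = A chi.
Hypothesis B_assoc : forall (u : units R) chi, B (val u *: chi) = B chi.

(** Row [chi] holds the coordinates, in the basis of characters, of the image of [chi] under the
    transition matrix. *)
Definition dual_walk chi psi : C :=
  A chi * (chi == psi)%:R + B chi * \sum_(a | a *: chi == psi) q a.

Definition qhat W (rho : lchar C (units (annq W))) : C :=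
  \sum_(a in units_add_ann W) q a * rho (to_units (\pi_(annq W) a)).

Definition cyclic_pair : pred {W : {set D} & lchar C (units (annq W))} :=
  fun p => is_cyclic (tag p).

Local Notation pairs := {p in cyclic_pair}.

Lemma big_pairs (S : Type) (idx : S) (op : Monoid.com_law idx)
    (F : forall W, lchar C (units (annq W)) -> S) :
  \big[op/idx]_(p : pairs) F _ (tagged (val p)) =
    \big[op/idx]_(W | is_cyclic W) \big[op/idx]_(rho : lchar C (units (annq W)))
      F W rho.
Proof.
rewrite (sig_big_dep _ (fun _ => xpredT) F).
under [RHS]eq_bigl do rewrite andbT.
by rewrite -(big_sub cyclic_pair (fun p => F _ (tagged p))).
Qed.

(** The character [rho] carried over to the generators of [W] and extended by 0; the boolean factor
    masks the junk of [unit_coord]. *)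
Definition block_fun psi W (rho : lchar C (units (annq W))) : C :=
  (cyclic_submod psi == W)%:R * rho (unit_coord gen W psi).

Definition block_dual W (rho : lchar C (units (annq W))) psi : C :=
  (cyclic_submod psi == W)%:R * (rho (unit_coord gen W psi))^-1 / #|{: units (annq W)}|%:R.

Definition pair_eigenvalue W (rho : lchar C (units (annq W))) : C :=
  A (gen W) + B (gen W) * qhat rho.

Lemma units_mulC (S : finComPzRingType) : commutative (@mulg (units S)).
Proof. by move=> u v; apply/val_inj/mulrC. Qed.

Lemma card_group_neq0 (G : finGroupType) : #|G|%:R != 0 :> C.
Proof. by rewrite pnatr_eq0 -lt0n -cardsT cardG_gt0. Qed.

(** Only [W = cyclic_submod psi] contributes; there the sum over [rho] is orthogonality of the
    characters of [U(R / ann W)], for two group elements. *)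
Lemma block_fun_dual psi psi' :
  \sum_(p : pairs) block_fun psi (tagged (val p)) * block_dual (tagged (val p)) psi'
    = (psi == psi')%:R.
Proof.
rewrite (big_pairs _ (fun W rho => block_fun psi rho * block_dual rho psi')).
pose W := cyclic_submod psi.
rewrite (bigD1 W) ?cyclic_submodP //= [X in _ + X]big1 ?addr0; last first.
  move=> W' /andP[_ neq]; rewrite big1 // => rho _.
  by rewrite /block_fun eq_sym (negPf neq) !mul0r.
have [psi'W | neq] := eqVneq (cyclic_submod psi') W; last first.
  rewrite big1 => [|rho _]; last by rewrite /block_dual (negPf neq) !mul0r mulr0.
  by case: eqVneq => // eq_psi; rewrite /W eq_psi eqxx in neq.
rewrite /block_fun /block_dual psi'W eqxx.
under eq_bigr do rewrite !mul1r mulrCA mulrA.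
rewrite -mulr_suml (lchar_orthogonal_char C (@units_mulC _)) mulrAC divff.
  by rewrite mul1r eq_sym (unit_coord_inj genP (cyclic_submodP psi)).
exact: card_group_neq0.
Qed.

(** Distinct submodules have disjoint sets of generators. Within one, the generators are reindexed
    by units, which gives orthogonality of two characters. *)
Lemma block_dual_fun (p p' : pairs) :
  \sum_psi block_dual (tagged (val p)) psi * block_fun psi (tagged (val p'))
    = (p == p')%:R.
Proof.
rewrite -val_eqE; case: p p' => [[W rho] /= cycW] [[W' rho'] /= cycW'].
have [eqW | neq] := eqVneq W W'; last first.
  rewrite big1 => [|psi _].
    by case: eqP => // -[/eqP]; rewrite (negPf neq).
  rewrite /block_dual /block_fun; case: eqP => [->|]; last by rewrite !mul0r.
  by rewrite (negPf neq) mul0r mulr0.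
case: W' / eqW in rho' cycW' *; rewrite eq_Tagged /=.
rewrite (bigID (fun psi => cyclic_submod psi == W)) /= addrC big1 ?add0r; last first.
  by move=> psi /negPf neq; rewrite /block_dual neq !mul0r.
rewrite (reindex (of_unit_coord gen (W := W))) /=; last first.
  exists (unit_coord gen W) => [u _|psi]; first exact: of_unit_coordK.
  by rewrite inE => /eqP; apply: unit_coordK.
rewrite (eq_bigl xpredT); last by move=> u; rewrite of_unit_coordP // eqxx.
rewrite /block_dual /block_fun.
under eq_bigr do rewrite of_unit_coordP // of_unit_coordK // eqxx !mul1r mulrAC.
rewrite -mulr_suml lchar_orthogonal_elt mulrAC divff ?mul1r //.
exact: card_group_neq0.
Qed.

Lemma dual_walk_sum psi (f : D -> C) :
  \sum_psi' dual_walk psi psi' * f psi' =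
    A psi * f psi + B psi * \sum_a q a * f (a *: psi).
Proof.
under eq_bigr do rewrite mulrDl.
rewrite big_split /=; congr (_ + _).
  rewrite (bigD1 psi) //= eqxx mulr1 big1 ?addr0 // => psi' neq.
  by rewrite eq_sym (negPf neq) mulr0 mul0r.
under eq_bigr do rewrite -mulrA mulr_suml.
rewrite -mulr_sumr; congr (_ * _).
rewrite (exchange_big_dep xpredT) //=; apply: eq_bigr => a _.
by rewrite (big_pred1 (a *: psi)) // => psi'; rewrite eq_sym.
Qed.

Lemma generator_invariant (f : D -> C) W psi :
    (forall (u : units R) chi, f (val u *: chi) = f chi) ->
  cyclic_submod psi = W -> f psi = f (gen W).
Proof.
move=> f_assoc psiW; have cycW : is_cyclic W by rewrite -psiW cyclic_submodP.
by have [u ->] := generator_associate genP cycW psiW; rewrite f_assoc.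
Qed.

(* If a multiple of psi generates W, then W is contained in R psi, and the size
   hypothesis forces equality. *)
Lemma dual_walk_block psi W (rho : lchar C (units (annq W))) :
    is_cyclic W -> (#|cyclic_submod psi| <= #|W|)%N ->
  \sum_psi' dual_walk psi psi' * block_fun psi' rho =
    pair_eigenvalue rho * block_fun psi rho.
Proof.
move=> cycW le_W; rewrite dual_walk_sum.
have [psiW | neq] := eqVneq (cyclic_submod psi) W.
  have -> : block_fun psi rho = rho (unit_coord gen W psi).
    by rewrite /block_fun psiW eqxx mul1r.
  rewrite mulrDl (generator_invariant A_assoc psiW).
  rewrite (generator_invariant B_assoc psiW) -mulrA; congr (_ + _ * _).
  (* The terms with [a] outside [units_add_ann W] vanish, since [a *: psi] then fails to generate
     [W]. *)
  rewrite /qhat [in RHS]big_mkcond mulr_suml; apply: eq_bigr => a _.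
  rewrite /block_fun (generator_scaleP genP) //; case: ifP => aW; last first.
    by rewrite !mul0r mulr0.
  by rewrite mul1r unit_coordM // lcharM mulrA.
have -> : block_fun psi rho = 0 by rewrite /block_fun (negPf neq) mul0r.
rewrite !mulr0 add0r big1 ?mulr0 // => a _.
rewrite /block_fun; case: eqP => [aW|]; last by rewrite mul0r mulr0.
case/eqP: neq; apply/eqP; rewrite eq_sym eqEcard le_W andbT -aW.
exact: cyclic_sub.
Qed.

(** In the basis of the [block_fun], the cardinal of [W] serves as height: by [dual_walk_block] a
    nonzero off-diagonal entry leads to a strictly smaller submodule, so [char_poly_triangular]
    applies. *)
Lemma char_poly_dual_walk :
  char_poly (fin_mx dual_walk) =
    \prod_(W | is_cyclic W) \prod_(rho : lchar C (units (annq W)))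
      ('X - (pair_eigenvalue rho)%:P).
Proof.
rewrite -(big_pairs _ (fun W rho => 'X - (pair_eigenvalue rho)%:P)).
rewrite (fin_mx_conj dual_walk block_fun_dual block_dual_fun).
pose b (p p' : pairs) := \sum_psi block_dual (tagged (val p)) psi *
  \sum_psi' dual_walk psi psi' * block_fun psi' (tagged (val p')).
rewrite -[fin_mx _]/(fin_mx b).
have bE (p p' : pairs) : (#|tag (val p)| <= #|tag (val p')|)%N ->
    b p p' = pair_eigenvalue (tagged (val p')) * (p == p')%:R.
  move=> le_pp'; rewrite -block_dual_fun mulr_sumr; apply: eq_bigr => psi _.
  rewrite [RHS]mulrCA.
  (* [block_dual] restricts the sum to generators [psi] of the first submodule, where [le_pp'] is
     the size hypothesis of [dual_walk_block]. *)
  have [eqW|neq] := eqVneq (cyclic_submod psi) (tag (val p)); last first.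
    by rewrite /block_dual (negPf neq) !mul0r.
  by rewrite dual_walk_block // ?eqW //; apply: (valP p').
rewrite (@char_poly_triangular _ _ _ (fun p : pairs => #|tag (val p)|)).
  by apply: eq_bigr => p _; rewrite bE // eqxx mulr1.
move=> p p' bpp' neq; rewrite ltnNge; apply: contra bpp' => /bE->.
by rewrite (negPf neq) mulr0.
Qed.

End Triangularization.

(** * From functions on the module to coordinates in the basis of characters *)

Section Walk.

Variables (C : numClosedFieldType) (R : finComPzRingType) (V : finPzLmodType R).
Local Notation D := (dual C V).

Variable gen : {set D} -> D.
Hypothesis genP : forall W, is_cyclic W -> W = cyclic_submod (gen W).

Lemma char_poly_walk (A B : D -> C) (q : R -> C) (m : V -> V -> C) :
    (forall (u : units R) chi, A (val u *: chi) = A chi) ->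
    (forall (u : units R) chi, B (val u *: chi) = B chi) ->
    (forall x (chi : D), \sum_y m x y * chi y =
       A chi * chi x + B chi * \sum_a q a * chi (a *: x)) ->
  char_poly (fin_mx m) =
    \prod_(W | is_cyclic W) \prod_(rho : lchar C (units (annq W)))
      ('X - (A (gen W) + B (gen W) * qhat q rho)%:P).
Proof.
move=> A_assoc B_assoc mE.
transitivity (char_poly (fin_mx (dual_walk A B q))); last first.
  exact: char_poly_dual_walk.
(* The images of characters are the rows of [dual_walk]; the intertwining by the character table
   needs them as columns. *)
rewrite -[RHS]char_poly_tr.
have -> : (fin_mx (dual_walk A B q))^T = fin_mx (fun psi chi => dual_walk A B q chi psi).
  by apply/matrixP => i j; rewrite !mxE.
have V_neq0 : #|V|%:R != 0 :> C.
  exact: (card_group_neq0 C (FinRing.Zmodule_to_finGroup V)).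
apply: (@fin_mx_intertwine _ _ _ _ _ (fun v (chi : D) => chi v)
  (fun (chi : D) v => (chi v)^-1 / #|V|%:R)).
- move=> x y; under eq_bigr do rewrite mulrCA mulrA.
  have := lchar_orthogonal_char C (G := FinRing.Zmodule_to_finGroup V) (@addrC V) y x.
  by rewrite -mulr_suml => ->; rewrite mulrAC divff // mul1r eq_sym.
- move=> chi psi; under eq_bigr do rewrite mulrAC.
  have := @lchar_orthogonal_elt C (FinRing.Zmodule_to_finGroup V) chi psi.
  by rewrite -mulr_suml => ->; rewrite mulrAC divff // mul1r.
move=> x chi; rewrite mE.
under [RHS]eq_bigr do rewrite mulrC.
rewrite (dual_walk_sum A B q chi (fun psi => psi x)); congr (_ + _ * _).
by apply: eq_bigr => a _; rewrite -dual_scaleE.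
Qed.

End Walk.

(** * Action of the two walks on characters *)

Section WalksOnCharacters.

Variables (K : realType) (R : finComPzRingType) (V : finPzLmodType R).
Variables (P : V -> K) (Q : R -> K).

(** The substitution of [u b] for [b] permutes [V] and preserves [P]. *)
Lemma Phat_associate (P_assoc : constant_on_associates P) (u : units R)
    (chi : dual K[i] V) :
  Phat P (val u *: chi) = Phat P chi.
Proof.
have uK (v : V) : val u *: (val (u^-1)%g *: v) = v.
  by rewrite scalerA -[X in X *: _]/(val (u * u^-1)%g) mulgV scale1r.
have Ku (v : V) : val (u^-1)%g *: (val u *: v) = v.
  by rewrite scalerA -[X in X *: _]/(val (u^-1 * u)%g) mulVg scale1r.
rewrite /Phat [RHS](reindex (fun v : V => val u *: v)) /=; last first.
  by exists (fun v => val (u^-1)%g *: v) => v _; [apply: Ku | apply: uK].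
apply: eq_bigr => b _; rewrite dual_scaleE; congr (_%:C * _).
by apply: P_assoc; exists (u^-1)%g; rewrite Ku.
Qed.

Lemma coin_toss_character alpha x (chi : dual K[i] V) :
  \sum_y (coin_toss_walk alpha P Q x y)%:C * chi y =
    alpha%:C * Phat P chi * chi x
    + (1 - alpha)%:C * \sum_a (Q a)%:C * chi (a *: x).
Proof.
have push (I : finType) (f : I -> V) (w : I -> K) :
    \sum_y (\sum_(i | f i == y) w i)%:C * chi y = \sum_i (w i)%:C * chi (f i).
  under eq_bigr do rewrite rmorph_sum mulr_suml.
  rewrite (exchange_big_dep xpredT) //=; apply: eq_bigr => i _.
  by rewrite (big_pred1 (f i)) // => y; rewrite eq_sym.
under eq_bigr do rewrite /coin_toss_walk rmorphD !rmorphM /= mulrDl -!mulrA.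
rewrite big_split /= -!mulr_sumr !push -mulrA; congr (_ * _ + _).
rewrite /Phat mulr_suml; apply: eq_bigr => b _.
by rewrite dualD mulrA mulrAC.
Qed.

(** As [chi (a *: x + b)] is [chi (a *: x) * chi b], independence of [a] and [b] splits the
    expectation into a product. *)
Lemma affine_character x (chi : dual K[i] V) :
  \sum_y (affine_walk P Q x y)%:C * chi y =
    Phat P chi * \sum_a (Q a)%:C * chi (a *: x).
Proof.
under eq_bigr do rewrite /affine_walk rmorph_sum mulr_suml.
rewrite exchange_big /= mulr_sumr; apply: eq_bigr => a _.
under eq_bigr do rewrite rmorph_sum mulr_suml.
rewrite (exchange_big_dep xpredT) //= /Phat mulr_suml; apply: eq_bigr => b _.
rewrite (big_pred1 (a *: x + b)); last by move=> y; rewrite eq_sym.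
by rewrite rmorphM /= dualD mulrACA [RHS]mulrC.
Qed.

Lemma map_transition_matrix (p : V -> V -> K) :
  map_mx (real_complex K) (transition_matrix p) = fin_mx (fun x y => (p x y)%:C).
Proof. by apply/matrixP => i j; rewrite !mxE. Qed.

End WalksOnCharacters.

Theorem theorem1p3 (K : realType) (R : finComPzRingType) (V : finPzLmodType R)
    (P : V -> K) (Q : R -> K)
    (P_prob : is_probability P) (P_assoc : constant_on_associates P)
    (Q_prob : is_probability Q)
    (gen : {set dual K[i] V} -> dual K[i] V)
    (genP : forall W, is_cyclic W -> W = cyclic_submod (gen W)) :
  (forall alpha : K, 0 <= alpha <= 1 ->
     char_poly (map_mx (real_complex K)
                  (transition_matrix (coin_toss_walk alpha P Q)))
     = \prod_(W : {set dual K[i] V} | is_cyclic W)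
         \prod_(rho : lchar K[i] (units (annq W)))
           ('X - (alpha%:C * Phat P (gen W) + (1 - alpha)%:C * Qhat Q rho)%:P))
  /\
  char_poly (map_mx (real_complex K) (transition_matrix (affine_walk P Q)))
  = \prod_(W : {set dual K[i] V} | is_cyclic W)
      \prod_(rho : lchar K[i] (units (annq W)))
        ('X - (Phat P (gen W) * Qhat Q rho)%:P).
Proof.
have PhatU := Phat_associate P_assoc.
split=> [alpha _|]; rewrite map_transition_matrix.
  apply: (char_poly_walk genP (A := fun chi => alpha%:C * Phat P chi)
    (B := fun=> (1 - alpha)%:C) (q := fun a => (Q a)%:C)) => //.
    by move=> u chi; rewrite PhatU.
  exact: coin_toss_character.
rewrite (char_poly_walk genP (A := fun=> 0) (B := Phat P)
  (q := fun a => (Q a)%:C)) //.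
  by do 2!apply: eq_bigr => ? _; rewrite add0r.
by move=> x chi; rewrite mul0r add0r affine_character.
Qed.
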